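(* Let $U\subseteq\mathbb C^p$ be a Zariski-open subset and $f:\mathbb C^p\to Z$ a rational morphism which is regular on $U$ and satisfies $f^{-1}(Z_0)\ne\emptyset$. If $F:U\to V$ is a holomorphic map with $\pi\circ F=f$ on $U$, then $F$ is regular (a morphism of algebraic varieties $U\to V$).
   Context: $V$ is a finite-dimensional complex vector space, $G\subset GL(V)$ a finite group, $Z=V/G$ realized as $\sigma(V)\subseteq\mathbb C^m$ via a minimal system of homogeneous generators $\sigma$ of $\mathbb C[V]^G$, with quotient map $\pi=\sigma$. $V_0$ is the set of points with trivial isotropy group and $Z_0=\pi(V_0)$. *)

(* Defs.v *)
From HB Require Import structures.
From mathcomp Require Import all_boot all_order all_algebra.
From mathcomp Require Import all_classical all_reals all_analysis.
From mathcomp Require Import complex.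
From mathcomp Require mpoly.
Import (canonicals) mpoly.
Import Order.TTheory GRing.Theory Num.Theory.
Import numFieldNormedType.Exports.

Set Implicit Arguments.
Unset Strict Implicit.
Unset Printing Implicit Defensive.

Local Open Scope ring_scope.
Local Open Scope classical_set_scope.

Section Defs.
Variable R : realType.
Local Notation C := (complex R).

Definition ev (n : nat) (q : mpoly.mpoly n C) (x : 'rV[C]_n) : C :=
  mpoly.meval (fun i => x ord0 i) q.

Definition zariski_open (p : nat) (U : set 'rV[C]_p) : Prop :=
  exists S : seq (mpoly.mpoly p C), U = [set x | has (fun s => ev s x != 0) S].

Definition regular_fun (p : nat) (U : set 'rV[C]_p) (h : 'rV[C]_p -> C) : Prop :=
  forall x, U x -> exists a b : mpoly.mpoly p C,
    ev b x != 0 /\ forall y, U y -> ev b y != 0 -> h y = ev a y / ev b y.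

Definition regular_map (p k : nat) (U : set 'rV[C]_p) (F : 'rV[C]_p -> 'rV[C]_k)
  : Prop := forall j : 'I_k, regular_fun U (fun x => F x ord0 j).

(* holomorphic on (the Euclidean-open set) U: complex (C-linear) Frechet
   differentiable at each point of U *)
Definition holomorphic_on (p k : nat) (U : set 'rV[C]_p) (F : 'rV[C]_p -> 'rV[C]_k)
  : Prop :=
  forall x : ('rV[C]_p : normedModType C), U x -> differentiable F x.

Definition finite_matrix_group (n : nat) (G : seq 'M[C]_n) : Prop :=
  [/\ 1%:M \in G,
      (forall g h, g \in G -> h \in G -> g *m h \in G) &
      (forall g, g \in G -> g \in unitmx)].

(* linear action of g on V = C^n (column-vector convention g.v, written on rows) *)
Definition act (n : nat) (g : 'M[C]_n) (x : 'rV[C]_n) : 'rV[C]_n := x *m g^T.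

Definition invariant (n : nat) (G : seq 'M[C]_n) (q : mpoly.mpoly n C) : Prop :=
  forall g, g \in G -> forall x, ev q (act g x) = ev q x.

Definition homogeneous (n : nat) (q : mpoly.mpoly n C) : Prop :=
  exists d : nat, all (fun mm => mpoly.mdeg mm == d) (mpoly.msupp q).

Definition generates (n m : nat) (G : seq 'M[C]_n)
  (sigma : m.-tuple (mpoly.mpoly n C)) : Prop :=
  forall q, invariant G q ->
    exists r : mpoly.mpoly m C, q = mpoly.comp_mpoly sigma r.

Definition drop_gen (n m : nat) (sigma : m.-tuple (mpoly.mpoly n C)) (i : 'I_m)
  : m.-tuple (mpoly.mpoly n C) :=
  [tuple if j == i then (0 : mpoly.mpoly n C) else tnth sigma j | j < m].

Definition minimal_gens (n m : nat) (sigma : m.-tuple (mpoly.mpoly n C)) : Prop :=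
  forall i : 'I_m, ~ exists r : mpoly.mpoly m C,
      tnth sigma i = mpoly.comp_mpoly (drop_gen sigma i) r.

Definition min_hom_generators (n m : nat) (G : seq 'M[C]_n)
  (sigma : m.-tuple (mpoly.mpoly n C)) : Prop :=
  [/\ (forall i : 'I_m, invariant G (tnth sigma i) /\ homogeneous (tnth sigma i)),
      generates G sigma & minimal_gens sigma].

Definition quot_map (n m : nat) (sigma : m.-tuple (mpoly.mpoly n C))
  (x : 'rV[C]_n) : 'rV[C]_m := \row_j ev (tnth sigma j) x.

Definition quotZ (n m : nat) (sigma : m.-tuple (mpoly.mpoly n C)) : set 'rV[C]_m :=
  range (quot_map sigma).

Definition V0 (n : nat) (G : seq 'M[C]_n) : set 'rV[C]_n :=
  [set x | forall g, g \in G -> act g x = x -> g = 1%:M].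

Definition Z0 (n m : nat) (G : seq 'M[C]_n) (sigma : m.-tuple (mpoly.mpoly n C))
  : set 'rV[C]_m := quot_map sigma @` V0 G.

End Defs.

(* Main.v *)
Require Import Defs.
From HB Require Import structures.
From mathcomp Require Import all_boot all_order all_algebra.
From mathcomp Require Import all_classical all_reals all_analysis.
From mathcomp Require Import complex.
From mathcomp Require mpoly qpoly.
From mathcomp Require Import ring lra zify.
Import (canonicals) mpoly.
Import Order.TTheory GRing.Theory Num.Theory.
Import numFieldNormedType.Exports.

(* A coordinate h of F is a root of the monic polynomial
   prod_(g in G) (T - (g v)_j) at v = F(x), whose coefficients are invariant,
   hence polynomials in sigma and regular functions of x. Near a point of U pick
   a polynomial s, nonzero at that point, with {s <> 0} contained in U and f
   regular with denominator a power of s; then H = s^D h is integral over the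
   polynomials on {s <> 0}.
   On a complex line, H becomes a continuous function of polynomial growth which
   is algebraic, hence smooth off finitely many points (discriminant). A maximum
   principle for powers of H, multiplied by a polynomial that kills the
   exceptional points, gives Liouville's theorem, so H is a polynomial of bounded
   degree on each line, and therefore a polynomial Q on {s <> 0} by
   interpolation. Thus h = Q / s^D. *)

Set Implicit Arguments.
Unset Strict Implicit.
Unset Printing Implicit Defensive.

Local Open Scope ring_scope.
Local Open Scope classical_set_scope.

(* [carath k b f]: [f] is [k] times differentiable at [b] in Caratheodory's
   sense. Only a continuous [f1] is asked for at the last stage, and [f1 b] is
   the derivative. *)
Fixpoint carath (K : numFieldType) (k : nat) (b : K) (f : K -> K) : Prop :=
  if k is k'.+1 then
    exists2 f1, carath k' b f1 & \forall t \near b, f t = f b + (t - b) * f1 t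
  else {for b, continuous f}.

(** * Calculus of iterated Caratheodory differentiability *)

Section Carath.
Variable K : numFieldType.
Implicit Types (b c : K) (f g : K -> K) (k : nat).

Lemma carath_continuous k b f : carath k b f -> {for b, continuous f}.
Proof.
elim: k f => [//|k IH] f /= [f1 /IH cf1 ef].
have H : (fun t => f b + (t - b) * f1 t) @ b --> f b + (b - b) * f1 b.
  exact: (cvgD (cvg_cst (f b)) (cvgM (cvgB cvg_id (cvg_cst b)) cf1)).
rewrite subrr mul0r addr0 in H.
have ef' : \forall t \near b, f b + (t - b) * f1 t = f t.
  by apply: filterS ef => t ->.
exact: (cvg_trans (near_eq_cvg ef') H).
Qed.

Lemma carathS k b f : carath k.+1 b f -> carath k b f.
Proof.
elim: k f => [|k IH] f H; first exact: (carath_continuous H).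
by case: H => f1 /IH cf1 ef; exists f1.
Qed.

Lemma carath_near k b f g :
  (\forall t \near b, f t = g t) -> carath k b f -> carath k b g.
Proof.
move=> fg; have efg := nbhs_singleton fg.
case: k => [|k] /=.
  by rewrite /prop_for /continuous_at -efg; exact: cvg_trans (near_eq_cvg fg).
case=> f1 cf1 ef; exists f1 => //.
by near=> t; rewrite -efg -(near fg t) //; near: t.
Unshelve. all: by end_near. Qed.

Lemma carath_cst k b c : carath k b (fun=> c).
Proof.
elim: k c => [|k IH] c /=; first exact: cst_continuous.
by exists (fun=> 0) => //; near=> t; rewrite mulr0 addr0.
Unshelve. all: by end_near. Qed.

Lemma carath_id k b : carath k b id.
Proof.
case: k => [|k] /=; first by move=> A.
by exists (fun=> 1); [exact: carath_cst|near=> t; rewrite mulr1 addrC subrK].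
Unshelve. all: by end_near. Qed.

Lemma carathD k b f g :
  carath k b f -> carath k b g -> carath k b (fun t => f t + g t).
Proof.
elim: k f g => [|k IH] f g /=; first by move=> cf cg; exact: (cvgD cf cg).
case=> f1 cf ef [g1 cg eg]; exists (fun t => f1 t + g1 t); first exact: IH.
near=> t; have -> : f t = f b + (t - b) * f1 t by near: t.
have -> : g t = g b + (t - b) * g1 t by near: t.
ring.
Unshelve. all: by end_near. Qed.

Lemma carathM k b f g :
  carath k b f -> carath k b g -> carath k b (fun t => f t * g t).
Proof.
elim: k f g => [|k IH] f g; first by move=> cf cg; exact: (cvgM cf cg).
move=> cf cg; have cg' := carathS cg.
case: cf cg => [f1 cf ef] [g1 cg eg].
exists (fun t => f1 t * g t + f b * g1 t).
  apply: carathD; first exact: IH.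
  by apply: IH => //; exact: carath_cst.
near=> t; have -> : f t = f b + (t - b) * f1 t by near: t.
have eg' : g t = g b + (t - b) * g1 t by near: t.
transitivity (f b * g t + (t - b) * f1 t * g t); first by ring.
rewrite {1}eg'; ring.
Unshelve. all: by end_near. Qed.

Lemma carathX k b f n : carath k b f -> carath k b (fun t => f t ^+ n).
Proof.
move=> cf; elim: n => [|n IH]; first exact: carath_cst.
apply: (@carath_near _ _ (fun t => f t * f t ^+ n)).
  by near=> t; rewrite exprS.
exact: carathM.
Unshelve. all: by end_near. Qed.

Lemma continuous_neq0 b f : {for b, continuous f} -> f b != 0 ->
  \forall t \near b, f t != 0.
Proof.
move=> cf fb0; apply: (@cvgr_neq0 _ _ _ _ _ _ _ cf) => //.
Qed.

Lemma carathV k b f : f b != 0 -> carath k b f -> carath k b (fun t => (f t)^-1).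
Proof.
move=> fb0; elim: k f fb0 => [|k IH] f fb0; first by move=> cf; exact: (cvgV fb0 cf).
move=> cf; have f0 := continuous_neq0 (carath_continuous cf) fb0.
have cf' := carathS cf.
case: cf => [f1 cf ef].
exists (fun t => (- (f b)^-1 * f1 t) * (f t)^-1).
  by do ![apply: carathM => //|exact: carath_cst|exact: IH].
near=> t; have ft0 : f t != 0 by near: t.
have eq1 : f t = f b + (t - b) * f1 t by near: t.
apply: (mulIf ft0); rewrite mulVf // mulrDl !mulrA.
rewrite [_ * (f t)^-1 * f t]mulfVK //.
rewrite [X in _ * X + _]eq1; field.
by [].
Unshelve. all: by end_near. Qed.

Lemma carath_sum k b (I : Type) (s : seq I) (f : I -> K -> K) :
  (forall i, carath k b (f i)) -> carath k b (fun t => \sum_(i <- s) f i t).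
Proof.
move=> cf; elim: s => [|i s IH].
  apply: (@carath_near _ _ (fun=> 0)); last exact: carath_cst.
  by near=> t; rewrite big_nil.
apply: (@carath_near _ _ (fun t => f i t + \sum_(i <- s) f i t)).
  by near=> t; rewrite big_cons.
exact: carathD.
Unshelve. all: by end_near. Qed.

Lemma carath_horner k b (p : {poly K}) : carath k b (fun t => p.[t]).
Proof.
apply: (@carath_near _ _ (fun t => \sum_(i < size p) p`_i * t ^+ i)).
  by near=> t; rewrite horner_coef.
apply: carath_sum => i; apply: carathM; first exact: carath_cst.
exact/carathX/carath_id.
Unshelve. all: by end_near. Qed.

(** [S] stands for S(t, x) with x the outer variable, so [S.[x%:P].[t]] is its value at (t, x). The
    algebraic equations below follow this convention. *)
Lemma carath_horner2 k b (S : {poly {poly K}}) f :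
  carath k b f -> carath k b (fun t => S.[(f t)%:P].[t]).
Proof.
move=> cf.
have cS : carath k b (fun t => \sum_(i < size S) (S`_i).[t] * f t ^+ i).
  apply: carath_sum => i; apply: carathM; first exact: carath_horner.
  exact: carathX.
apply: carath_near cS; near=> t.
rewrite (horner_coef S) horner_sum; apply: eq_bigr => i _.
by rewrite hornerM horner_exp hornerC.
Unshelve. all: by end_near. Qed.

(* A simple root of a polynomial equation satisfies [e t - e b = (t - b) * q t]
   with [q] a rational expression in [t] and [e t], hence gains one order of
   regularity at each turn. *)
Lemma carath_simple_root k b (S : {poly {poly K}}) (e : K -> K) :
  {for b, continuous e} -> (\forall t \near b, S.[(e t)%:P].[t] = 0) ->
  (deriv S).[(e b)%:P].[b] != 0 -> carath k b e.
Proof.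
move=> ce S0 dS.
have [q qE] : exists q : {poly {poly K}},
    S - (S.[(e b)%:P])%:P = q * ('X - ((e b)%:P)%:P).
  by apply/factor_theorem; rewrite /root !hornerE subrr.
(* The value of [q] at (b, e b) is the partial derivative of S in x. *)
have qb : q.[(e b)%:P].[b] != 0.
  suff <- : (deriv S).[(e b)%:P] = q.[(e b)%:P] by [].
  have -> : deriv S = (deriv (S - (S.[(e b)%:P])%:P)) by rewrite derivB derivC subr0.
  by rewrite qE derivM derivXsubC mulr1 !hornerE subrr mulr0 add0r.
have [r rE] : exists r : {poly K}, S.[(e b)%:P] = r * ('X - b%:P).
  by apply/factor_theorem; rewrite /root (nbhs_singleton S0).
have q0 : \forall t \near b, q.[(e t)%:P].[t] != 0.
  apply: (@continuous_neq0 b (fun t => q.[(e t)%:P].[t])) => //.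
  exact: (@carath_horner2 0).
elim: k => [//|k IH].
(* Since S(t, e t) = 0 and S(t, e b) = r(t) (t - b), one has q(t, e t) (e t - e b) = - r(t) (t -
   b). *)
exists (fun t => - r.[t] * (q.[(e t)%:P].[t])^-1).
  apply: carathM; last by apply: carathV => //; exact: carath_horner2.
  apply: (@carath_near _ _ (fun t => (- r).[t])); last exact: carath_horner.
  by near=> t; rewrite hornerN.
near=> t.
have St : S.[(e t)%:P].[t] = 0 by near: t.
have qt : q.[(e t)%:P].[t] != 0 by near: t.
have H := congr1 (fun p => p.[(e t)%:P].[t]) qE.
rewrite rE !hornerE St sub0r in H.
apply: (mulfI qt); transitivity (q.[(e t)%:P].[t] * e b - r.[t] * (t - b)).
  have -> : r.[t] * (t - b) = - (q.[(e t)%:P].[t] * (e t - e b)).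
    by rewrite -H opprK.
  by ring.
by field.
Unshelve. all: by end_near. Qed.
End Carath.

(** * Regularity of continuous algebraic functions off finitely many points *)

Section AlgebraicFunction.
Variable K : numFieldType.
Local Notation KXY := {poly {poly K}}.

(** Coprimality here is over the fraction field K(t). Clearing denominators in a Bezout relation
    leaves a nonzero polynomial D(t), and common zeros can only lie over its roots. *)
Lemma Bezout_coprimep_eval (p q : KXY) : coprimep p q ->
  exists2 D : {poly K}, D != 0 & forall t x, D.[t] != 0 ->
    p.[x%:P].[t] = 0 -> q.[x%:P].[t] != 0.
Proof.
move=> /Bezout_coprimepP[[u v] /= /eqpP[[c1 c2] /= /andP[c10 c20] E]].
exists c2 => // t x c2t pt0; apply: contra c2t => /eqP qt0.
have := congr1 (fun p => p.[x%:P].[t]) E.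
by rewrite !hornerE pt0 qt0 !mulr0 addr0 mulr0 => <-.
Qed.

(** Induction on the degree in x. If P is coprime to its x-derivative, its roots are simple off the
    roots of some D(t). Otherwise write c P = R g with g the gcd of P and its derivative. If R and g
    are coprime, then off finitely many b only one of them vanishes at (b, e b); by continuity the
    other stays nonzero nearby, and induction applies to the vanishing one. If they share a factor
    w, with R and g proportional to R1 w and g1 w, the product R1 g1 w still vanishes along [e] and
    has smaller degree than P. *)
Lemma algebraic_carath (P : KXY) (k : nat) : P != 0 ->
  exists2 B : {poly K}, B != 0 & forall b (e : K -> K), B.[b] != 0 ->
    {for b, continuous e} -> (\forall t \near b, P.[(e t)%:P].[t] = 0) ->
    carath k b e.
Proof.
have [n] := ubnP (size P); elim: n P => // n IH P; rewrite ltnS => sP P0.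
have [cop|ncop] := boolP (coprimep P (deriv P)).
  have [D D0 DP] := Bezout_coprimep_eval cop.
  exists D => // b e Db ce Pe; apply: (carath_simple_root _ ce Pe).
  exact/DP/(nbhs_singleton Pe).
set g := gcdp P (deriv P).
have g0 : g != 0 by rewrite gcdp_eq0 negb_and P0.
have sg : (1 < size g)%N.
  by rewrite ltn_neqAle eq_sym ncop lt0n size_poly_eq0.
(* In characteristic zero a vanishing derivative would make P constant in x, hence coprime to its
   derivative. *)
have dP0 : deriv P != 0.
  apply: contraNneq ncop => dP0; rewrite /coprimep dP0 gcdp0.
  have : (size P <= 1)%N.
    rewrite leqNgt; apply/negP => sP1.
    have /(congr1 (fun q : KXY => q`_(size P).-2)) := dP0.
    rewrite coef_deriv coef0 -mulr_natr.
    have -> : (size P).-2.+1 = (size P).-1 by case: (size P) sP1 => [|[]].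
    move/eqP; rewrite mulf_eq0 -lead_coefE lead_coef_eq0 (negbTE P0) /=.
    rewrite -(rmorph_nat polyC) polyC_eq0 pnatr_eq0.
    by case: (size P) sP1 => [|[]].
  by rewrite leq_eqVlt ltnS leqn0 size_poly_eq0 (negbTE P0) orbF.
have sgP : (size g < size P)%N.
  apply: leq_ltn_trans (lt_size_deriv P0).
  by apply: dvdp_leq => //; exact: dvdp_gcdr.
have /Pdiv.Idomain.dvdpP[[c R] /= c0 cP] : g %| P by exact: dvdp_gcdl.
have R0 : R != 0.
  apply: contraNneq P0 => R0; move/eqP: cP.
  by rewrite R0 mul0r scale_poly_eq0 (negbTE c0).
have sRg : size P = (size R + size g).-1.
  by rewrite -(size_scale P c0) cP size_mul.
have Rg t x : P.[x%:P].[t] = 0 -> R.[x%:P].[t] * g.[x%:P].[t] = 0.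
  move=> Pt; have := congr1 (fun p => p.[x%:P].[t]) cP.
  by rewrite hornerZ !hornerM Pt mulr0.
have sR : (size R < size P)%N by rewrite sRg; lia.
have [cRg|ncRg] := boolP (coprimep R g).
  have [BR BR0 HR] := IH R (leq_trans sR sP) R0.
  have [Bg Bg0 Hg] := IH g (leq_trans sgP sP) g0.
  have [D D0 DP] := Bezout_coprimep_eval cRg.
  exists (BR * Bg * D); first by rewrite !mulf_neq0.
  move=> b e; rewrite !hornerM !mulf_eq0 !negb_or => /andP[/andP[BRb Bgb] Db].
  move=> ce Pe; have := Rg _ _ (nbhs_singleton Pe).
  have ce' (q : KXY) : {for b, continuous (fun t => q.[(e t)%:P].[t])}.
    exact: (@carath_horner2 _ 0).
  move=> /eqP; rewrite mulf_eq0 => /orP[/eqP Rb|/eqP gb].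
    have gb := continuous_neq0 (ce' g) (DP _ _ Db Rb).
    apply: HR => //; near=> t.
    have gt : g.[(e t)%:P].[t] != 0 by near: t.
    have /Rg /eqP : P.[(e t)%:P].[t] = 0 by near: t.
    by rewrite mulf_eq0 (negbTE gt) orbF => /eqP.
  have Rb : R.[(e b)%:P].[b] != 0.
    by apply/eqP => /(DP _ _ Db); rewrite gb eqxx.
  have {}Rb := continuous_neq0 (ce' R) Rb.
  apply: Hg => //; near=> t.
  have Rt : R.[(e t)%:P].[t] != 0 by near: t.
  have /Rg /eqP : P.[(e t)%:P].[t] = 0 by near: t.
  by rewrite mulf_eq0 (negbTE Rt) => /eqP.
set w := gcdp R g.
have w0 : w != 0 by rewrite gcdp_eq0 negb_and R0.
have sw : (1 < size w)%N.
  by rewrite ltn_neqAle eq_sym ncRg lt0n size_poly_eq0.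
have /Pdiv.Idomain.dvdpP[[c1 R1] /= c10 cR] : w %| R by exact: dvdp_gcdl.
have /Pdiv.Idomain.dvdpP[[c2 g1] /= c20 cg] : w %| g by exact: dvdp_gcdr.
have R10 : R1 != 0.
  apply: contraNneq R0 => R10; move/eqP: cR.
  by rewrite R10 mul0r scale_poly_eq0 (negbTE c10).
have g10 : g1 != 0.
  apply: contraNneq g0 => g10; move/eqP: cg.
  by rewrite g10 mul0r scale_poly_eq0 (negbTE c20).
have sR1 : size R = (size R1 + size w).-1.
  by rewrite -(size_scale R c10) cR size_mul.
have sg1 : size g = (size g1 + size w).-1.
  by rewrite -(size_scale g c20) cg size_mul.
have m0 : R1 * g1 * w != 0 by rewrite !mulf_neq0.
have sm : (size (R1 * g1 * w : KXY)%R < n)%N.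
  rewrite !size_mul ?mulf_neq0 //.
  move: sw; rewrite -!size_poly_gt0 in R10 g10 R0 g0.
  lia.
have [B B0 HB] := IH _ sm m0.
exists B => // b e Bb ce Pe; apply: HB => //; near=> t.
have /Rg H : P.[(e t)%:P].[t] = 0 by near: t.
have E1 := congr1 (fun p => p.[(e t)%:P].[t]) cR.
have E2 := congr1 (fun p => p.[(e t)%:P].[t]) cg.
rewrite /= hornerZ !hornerM in E1; rewrite /= hornerZ !hornerM in E2.
rewrite !hornerM.
have : (c1.[t] * R.[(e t)%:P].[t]) * (c2.[t] * g.[(e t)%:P].[t]) = 0.
  by rewrite mulrACA H mulr0.
rewrite E1 E2 => /eqP; rewrite !mulf_eq0 => H'; apply/eqP.
by rewrite !mulf_eq0; case/orP: H' => /orP[]->; rewrite ?orbT.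
Unshelve. all: by end_near. Qed.

End AlgebraicFunction.

(** * A maximum principle in the complex plane *)

Section MaximumPrinciple.
Variable R : realType.
Local Notation C := (R[i] : numFieldType).
Local Notation Re := (@complex.Re R).
Local Notation Im := (@complex.Im R).
Implicit Types (z t b : C).
Local Open Scope complex_scope.

Let sq z : R := Re z ^+ 2 + Im z ^+ 2.

Lemma norm_real_complex (x : R) : `|x%:C| = `|x|%:C.
Proof. by rewrite normc_def /= expr0n addr0 sqrtr_sqr. Qed.

Lemma normr_Re_le z (m : R) : `|z| <= m%:C -> `|Re z| <= m.
Proof. by move=> zm; rewrite -lecR; exact: le_trans (normc_ge_Re z) zm. Qed.

Lemma normr_Im_le z (m : R) : `|z| <= m%:C -> `|Im z| <= m.
Proof.
move=> zm; have -> : Im z = - Re (z * 'i) by rewrite ReiNIm opprK.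
rewrite normrN; apply: normr_Re_le; rewrite normrM.
by rewrite (_ : `|'i| = 1) ?mulr1 // normc_def /= expr0n add0r expr1n sqrtr1.
Qed.

(** In the partial order of R[i] positive elements are real, so every epsilon can be taken in R. *)
Lemma gt0_complexP (e : C) : 0 < e -> exists2 x : R, 0 < x & e = x%:C.
Proof.
rewrite ltcE /= => /andP[/eqP ime ree]; exists (Re e) => //.
by case: e ime ree => x y /= ->.
Qed.

Lemma continuous_Re (T : topologicalType) (f : T -> C) (a : T) :
  {for a, continuous f} -> {for a, continuous (fun x => Re (f x))}.
Proof.
move=> cf; apply/cvgrPdist_le => /= e e0.
have e0' : 0 < e%:C :> C by rewrite ltcR.
have /cvgrPdist_le /(_ _ e0') := cf.
by apply: filterS => x /normr_Re_le; rewrite raddfB.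
Qed.

Lemma continuous_Complex : continuous (fun p : R * R => p.1 +i* p.2 : C).
Proof.
move=> [x y]; apply/cvgrPdist_le => /= e /gt0_complexP[{}e e0 ->].
have e20 : 0 < e / 2 by rewrite divr_gt0.
near=> p.
have h1 : `|x - p.1| <= e / 2.
  near: p; have /cvgrPdist_le /(_ _ e20) : fst p @[p --> (x, y)] --> x by exact: cvg_fst.
  by [].
have h2 : `|y - p.2| <= e / 2.
  near: p; have /cvgrPdist_le /(_ _ e20) : snd p @[p --> (x, y)] --> y by exact: cvg_snd.
  by [].
have -> : x +i* y - p.1 +i* p.2 = (x - p.1)%:C + 'i * (y - p.2)%:C.
  by rewrite [LHS]complexE.
rewrite (splitr e) [leRHS]raddfD /=; apply: le_trans (ler_normD _ _) _.
rewrite normrM (_ : `|'i| = 1) ?mul1r ?norm_real_complex ?norm_real_complex; last first.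
  by rewrite normc_def /= expr0n add0r expr1n sqrtr1.
by rewrite lerD // lecR.
Unshelve. all: by end_near. Qed.

(** The excess 4 e^2 is the strict subharmonicity of the squared modulus; it will outweigh the
    remainders of a second-order expansion. *)
Lemma sum_sq_shift b (e : R) :
  sq (b + e%:C) + sq (b - e%:C) + sq (b + 'i * e%:C) + sq (b - 'i * e%:C) =
  4 * sq b + 4 * e ^+ 2.
Proof.
case: b => x y; rewrite /sq /=; ring.
Qed.

(* Averaging over [b + h] with [h] in {e, -e, ie, -ie} cancels the linear and
   quadratic terms of the expansion of [g] at [b]. *)
Lemma carath2_no_local_max (g : C -> C) b (d r : R) :
  carath 2 b g -> 0 < d -> 0 < r -> exists2 h : C, `|h| <= r%:C &
    Re (g b) + d * sq b < Re (g (b + h)) + d * sq (b + h).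
Proof.
move=> [g1 [g2 cg2 eg1] eg] d0 r0.
have d20 : 0 < (d / 2)%:C :> C by rewrite ltcR divr_gt0.
have : \forall t \near b, `|g2 b - g2 t| <= (d / 2)%:C /\
    g t = g b + (t - b) * (g1 b + (t - b) * g2 t).
  near=> t; split.
    near: t; have /cvgrPdist_le /(_ _ d20) := cg2; exact.
  have -> : g t = g b + (t - b) * g1 t by near: t.
  by congr (_ + _ * _); near: t.
rewrite -nbhs_nearE => /nbhs_ballP[e' /= /gt0_complexP[e e0 ->]] Hb.
pose s := Num.min (e / 2) r.
have s0 : 0 < s by rewrite lt_min r0 divr_gt0.
have Hs h : `|h| = s%:C -> `|g2 b - g2 (b + h)| <= (d / 2)%:C /\
    g (b + h) = g b + h * (g1 b + h * g2 (b + h)).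
  move=> hs; have := Hb (b + h); rewrite (addrC b h) addrK; apply.
  rewrite -ball_normE /= opprD addrCA subrr addr0 normrN hs ltcR.
  by rewrite gt_min; apply/orP; left; rewrite ltr_pdivrMr // mulr2n; lra.
have n1 : `|s%:C| = s%:C by rewrite norm_real_complex gtr0_norm.
have n2 : `|- s%:C| = s%:C by rewrite normrN.
have n3 : `|'i * s%:C| = s%:C.
  by rewrite normrM n1 normc_def /= expr0n add0r expr1n sqrtr1 mul1r.
have n4 : `|- ('i * s%:C)| = s%:C by rewrite normrN.
apply: contrapT => H.
have Hle h : `|h| = s%:C ->
    Re (g (b + h)) + d * sq (b + h) <= Re (g b) + d * sq b.
  move=> hs; rewrite leNgt; apply/negP => Hlt; apply: H; exists h => //.
  by rewrite hs lecR ge_min lexx orbT.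
have [[a1 b1] [a2 b2]] := (Hs _ n1, Hs _ n2).
have [[a3 b3] [a4 b4]] := (Hs _ n3, Hs _ n4).
have := lerD (lerD (Hle _ n1) (Hle _ n2)) (lerD (Hle _ n3) (Hle _ n4)).
have E : g (b + s%:C) + g (b - s%:C) + g (b + 'i * s%:C) + g (b - 'i * s%:C)
  = 4 * g b - (s ^+ 2)%:C * ((g2 b - g2 (b + s%:C)) + (g2 b - g2 (b - s%:C))
     - (g2 b - g2 (b + 'i * s%:C)) - (g2 b - g2 (b - 'i * s%:C))).
  rewrite b1 b2 b3 b4 rmorphXn /=.
  have i2 : 'i ^+ 2 = -1 :> C by rewrite sqr_i.
  set u := g2 _; set v := g2 _; set w := g2 (_ + 'i * _); set x := g2 (_ - 'i * _).
  have -> : 'i * s%:C * (g1 b + 'i * s%:C * w) =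
    'i * s%:C * g1 b + 'i ^+ 2 * s%:C ^+ 2 * w by ring.
  have -> : - ('i * s%:C) * (g1 b + - ('i * s%:C) * x) =
    - ('i * s%:C * g1 b) + 'i ^+ 2 * s%:C ^+ 2 * x by ring.
  rewrite i2; ring.
have ReE (G1 G2 G3 G4 G0 A1 A2 A3 A4 : C) (x : R) :
    G1 + G2 + G3 + G4 = 4 * G0 - x%:C * (A1 + A2 - A3 - A4) ->
    Re G1 + Re G2 + Re G3 + Re G4 =
      4 * Re G0 - x * (Re A1 + Re A2 - Re A3 - Re A4).
  have -> : (4 : C) = (4%:R : R)%:C by rewrite rmorph_nat.
  move: G1 G2 G3 G4 G0 A1 A2 A3 A4.
  move=> [? ?] [? ?] [? ?] [? ?] [? ?] [? ?] [? ?] [? ?] [? ?].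
  by move=> /(congr1 Re) /=; rewrite !mul0r !subr0.
move/ReE: E.
have := congr1 (fun x => d * x) (sum_sq_shift b s); rewrite /= !mulrDr.
have Re2 z : `|z| <= (d / 2)%:C -> `|Re z| <= d / 2 by exact: normr_Re_le.
move: (Re2 _ a1) (Re2 _ a2) (Re2 _ a3) (Re2 _ a4).
rewrite !ler_norml => {Re2} /andP[p1 q1] /andP[p2 q2] /andP[p3 q3] /andP[p4 q4].
move=> e1 e2 e3.
set A1 := Re (_ - g2 (b + s%:C)) in p1 q1 e2.
set A2 := Re (_ - g2 (b - s%:C)) in p2 q2 e2.
set A3 := Re (_ - g2 (b + 'i * s%:C)) in p3 q3 e2.
set A4 := Re (_ - g2 (b - 'i * s%:C)) in p4 q4 e2.
(* The four remainders cost at most 2 d s^2, whereas the term in [d] gains 4 d s^2. *)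
have sS : s ^+ 2 * (A1 + A2 - A3 - A4) <= s ^+ 2 * (2 * d).
  by apply: ler_wpM2l; [exact: sqr_ge0|lra].
have sd : 0 < s ^+ 2 * d by rewrite mulr_gt0 // exprn_gt0.
lra.
Unshelve. all: by end_near. Qed.

Lemma sq_norm z (m : R) : 0 <= m -> (`|z| <= m%:C) = (sq z <= m ^+ 2).
Proof.
move=> m0; rewrite normc_def lecR -(@ler_pXn2r _ 2) ?nnegrE ?sqrtr_ge0 //.
by rewrite sqr_sqrtr // addr_ge0 // sqr_ge0.
Qed.

(* A maximum of [Re (c G) + d |t|^2] on the square of half-side [rho], for a
   unit [c] and a small [d > 0], is excluded both in the interior and on the
   boundary. *)
Lemma maximum_principle (G : C -> C) (rho m : R) b :
  continuous G -> (forall t, G t != 0 -> carath 2 t G) -> 0 <= m ->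
  (forall t, rho%:C <= `|t| <= (2 * rho)%:C -> `|G t| <= m%:C) ->
  `|b| < rho%:C -> `|G b| <= m%:C.
Proof.
move=> cG G2 m0 bd brho.
have rho0 : 0 < rho by rewrite -ltcR; exact: le_lt_trans (normr_ge0 b) brho.
have [nb nbE] : exists nb : R, `|G b| = nb%:C.
  by exists (Re `|G b|); rewrite RRe_real // normr_real.
rewrite nbE lecR leNgt; apply/negP => mnb.
have nb0 : 0 < nb by exact: le_lt_trans mnb.
have Gb0 : G b != 0 by rewrite -normr_gt0 nbE ltcR.
(* A unit that rotates [G b] onto the positive real axis. *)
pose c : C := nb%:C / G b.
have c1 : `|c| = 1.
  by rewrite normrM normfV nbE norm_real_complex gtr0_norm // divff // -nbE normr_eq0.
have cGb : c * G b = nb%:C by rewrite divfK.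
(* On the square |t|^2 <= 2 rho^2, so d |t|^2 is at most half of the gap nb - m. *)
pose d := (nb - m) / (4 * rho ^+ 2).
have rho20 : 0 < rho ^+ 2 by rewrite exprn_gt0.
have d0 : 0 < d by rewrite divr_gt0 ?subr_gt0 // mulr_gt0.
have dE : d * (4 * rho ^+ 2) = nb - m by rewrite divfK // gt_eqF // mulr_gt0.
pose U t := Re (c * G t) + d * sq t.
have ReG t (k : R) : `|G t| <= k%:C -> Re (c * G t) <= k.
  move=> Gk; apply: le_trans (ler_norm _) _; apply: normr_Re_le.
  by rewrite normrM c1 mul1r.
pose V (p : R * R) := U (p.1 +i* p.2).
(* The square is compact as a product of segments, and its boundary lies in the annulus where [bd]
   holds. *)
have [[x y]] : exists2 p, p \in `[-rho, rho]%classic `*` `[-rho, rho]%classic &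
    forall q, q \in `[-rho, rho]%classic `*` `[-rho, rho]%classic -> V q <= V p.
  apply: compact_EVT_max.
  - by exists (0, 0); split; rewrite /= in_itv /= oppr_le0 ltW.
  - by apply: compact_setX; exact: segment_compact.
  - apply: continuous_subspaceT => p.
    have cRe : {for p, continuous (fun q : R * R => Re (c * G (q.1 +i* q.2)))}.
      apply: continuous_Re; apply: (cvgM (cvg_cst c)).
      exact: (continuous_comp (@continuous_Complex p) (cG _)).
    have csq : {for p, continuous (fun q : R * R =>
        d * (q.1 * q.1 + q.2 * q.2))}.
      apply: (cvgM (cvg_cst d)).
      exact: (cvgD (cvgM cvg_fst cvg_fst) (cvgM cvg_snd cvg_snd)).
    exact: (cvgD cRe csq).
rewrite inE => -[/=]; rewrite !in_itv /= => xr yr maxV.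
have {}maxV t : `|Re t| <= rho -> `|Im t| <= rho -> U t <= U (x +i* y).
  case: t => x' y' /=; rewrite !ler_norml => x'r y'r.
  by apply: (maxV (x', y')); rewrite inE; split; rewrite /= in_itv.
set t0 : C := x +i* y in maxV.
have Ub : nb <= U t0.
  apply: le_trans (maxV b _ _); first by
    rewrite /U cGb /= lerDl mulr_ge0 ?(ltW d0) // addr_ge0 // sqr_ge0.
  - by apply: normr_Re_le; exact: ltW.
  - by apply: normr_Im_le; exact: ltW.
have sqt0 : sq t0 <= 2 * rho ^+ 2.
  have sqle (a : R) : -rho <= a <= rho -> a ^+ 2 <= rho ^+ 2.
    rewrite -ler_norml => ar; rewrite -(real_normK (num_real a)) ler_pXn2r // nnegrE //.
    exact: ltW.
  by have := sqle _ xr; have := sqle _ yr; rewrite /sq /t0 /=; lra.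
have dsq : d * sq t0 < nb - m.
  rewrite -dE ltr_pM2l //; lra.
(* A zero of [G] could not reach the value [nb]; hence [G2] is available at the maximum point. *)
have Gt0 : G t0 != 0.
  apply/eqP => Gt0; move: Ub; rewrite /U Gt0 mulr0 /=; lra.
have nin : ~ (`|x| < rho /\ `|y| < rho).
  move=> [xin yin].
  pose r := Num.min (rho - `|x|) (rho - `|y|).
  have r0 : 0 < r by rewrite lt_min !subr_gt0 xin yin.
  have cg : carath 2 t0 (fun t => c * G t).
    by apply: carathM; [exact: carath_cst|exact: G2].
  have [h hr] := carath2_no_local_max cg d0 r0.
  rewrite ltNge => /negP; apply; apply: maxV; rewrite raddfD /=.
    apply: le_trans (ler_normD _ _) _.
    have := normr_Re_le hr; rewrite le_min => /andP[]; lra.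
  apply: le_trans (ler_normD _ _) _.
  have := normr_Im_le hr; rewrite le_min => /andP[]; lra.
have rt0 : rho%:C <= `|t0|.
  have [xr'|xr'] := leP rho `|x|.
    by apply: le_trans (normc_ge_Re t0); rewrite lecR.
  have [yr'|yr'] := leP rho `|y|; last by case: nin.
  have /normr_Im_le : `|t0| <= (Re `|t0|)%:C by rewrite RRe_real // normr_real.
  move=> /(le_trans yr'); rewrite -lecR => /le_trans; apply.
  by rewrite RRe_real // normr_real.
have t0r : `|t0| <= (2 * rho)%:C by rewrite sq_norm; nra.
have := ReG _ _ (bd t0 _); rewrite rt0 t0r => /(_ isT).
by move: Ub; rewrite /U; lra.
Qed.
End MaximumPrinciple.

(** * Liouville's theorem with finitely many exceptional points *)

Section Liouville.

Lemma horner_le_growth (K : numFieldType) (p : {poly K}) :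
  exists2 M : K, 0 <= M & forall t, `|p.[t]| <= M * (1 + `|t|) ^+ (size p).-1.
Proof.
exists (\sum_(i < size p) `|p`_i|); first by apply: sumr_ge0.
move=> t; rewrite horner_coef mulr_suml; apply: le_trans (ler_norm_sum _ _ _) _.
apply: ler_sum => i _; rewrite normrM normrX ler_wpM2l //.
have t1 : 1 <= 1 + `|t| by rewrite lerDl.
apply: (@le_trans _ _ ((1 + `|t|) ^+ i)).
  by rewrite lerXn2r ?nnegrE ?addr_ge0 // lerDr.
by rewrite ler_weXn2l //; have := ltn_ord i; lia.
Qed.

(** Used at the exceptional points, where nothing is known of the function beyond a bound by a
    continuous function that vanishes there. *)
Lemma continuous_dominated (K : numFieldType) (f g : K -> K) (c t : K) :
  {for t, continuous g} -> g t = 0 -> (forall s, `|f s| <= c * `|g s|) ->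
  {for t, continuous f}.
Proof.
move=> cg gt fg.
have ft : f t = 0.
  by apply/eqP; rewrite -normr_le0; have := fg t; rewrite gt normr0 mulr0.
have cg' : (fun s => c * `|g s|) @ t --> c * `|g t|.
  exact: (cvgM (cvg_cst c) (cvg_norm cg)).
apply/(@cvgrPdist_le _ _ K (nbhs t)) => /= e e0; have /cvgrPdist_le /(_ _ e0) := cg'.
apply: filterS => s; rewrite /= gt ft normr0 mulr0 !sub0r !normrN; apply: le_trans.
by rewrite [leRHS]ger0_norm // (le_trans _ (fg s)).
Qed.

Lemma injective_nonroot (K : idomainType) (p : {poly K}) (u : nat -> K) :
  injective u -> p != 0 -> exists i, p.[u i] != 0.
Proof.
move=> uI p0; apply: contrapT => H.
have /(max_poly_roots p0) : all (root p) [seq u i | i <- iota 0 (size p)].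
  apply/allP => _ /mapP[i _ ->]; apply/negPn/negP => px.
  by apply: H; exists i.
by rewrite map_inj_uniq ?iota_uniq // size_map size_iota ltnn => /(_ isT).
Qed.

Lemma numField_nonroot (K : numFieldType) (p : {poly K}) :
  p != 0 -> exists t, p.[t] != 0.
Proof.
move=> /(injective_nonroot (u := fun i => i%:R)) H.
have [|i pi] := H; first by move=> i j /eqP; rewrite eqr_nat => /eqP.
by exists i%:R.
Qed.

Variable R : realType.
Local Notation C := (R[i] : numFieldType).
Local Open Scope complex_scope.
Local Notation Re := (@complex.Re R).

Lemma norm_complexE (z : C) : exists2 x : R, 0 <= x & `|z| = x%:C.
Proof.
exists (Re `|z|); last by rewrite RRe_real // normr_real.
by rewrite -ler0c RRe_real // normr_real.
Qed.

(** The maximum principle is applied to q^N B: the factor B kills the uncontrolled values of q at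
    its roots, and a large N makes the size of B harmless. *)
Lemma vanishing_at_infinity (B : {poly C}) (q : C -> C) (K : C) :
  (forall t, B.[t] != 0 -> carath 2 t q) ->
  (forall t, B.[t] != 0 -> `|q t| * (1 + `|t|) <= K) ->
  forall t, B.[t] != 0 -> q t = 0.
Proof.
move=> q2 qK b Bb; apply/eqP/negPn/negP => qb.
have K0 : 0 < K.
  by apply: lt_le_trans (qK b Bb); rewrite mulr_gt0 ?normr_gt0 // ltr_wpDr.
have [k k0 kE] := gt0_complexP K0.
have [h h0 hE] := norm_complexE (q b).
have [be be0 beE] := norm_complexE b.
have [Bn Bn0 BnE] := norm_complexE B.[b].
have {}h0 : 0 < h by rewrite -ltcR -hE normr_gt0.
have {}Bn0 : 0 < Bn by rewrite -ltcR -BnE normr_gt0.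
(* The first term forces |q| <= h / 2 beyond radius [rho], by [qK]; the other two put [b] inside the
   disc. *)
pose rho := 2 * k / h + be + 1.
have kh0 : 0 <= 2 * k / h by rewrite !mulr_ge0 ?invr_ge0 // ltW.
have rho0 : 0 < rho by rewrite /rho; lra.
have qh t : B.[t] != 0 -> rho%:C <= `|t| -> `|q t| <= (h / 2)%:C.
  move=> Bt tr; have [x x0 xE] := norm_complexE (q t).
  have [y y0 yE] := norm_complexE t; have := qK t Bt.
  move: tr; rewrite xE yE kE lecR => ry.
  rewrite -(rmorph1 (real_complex R)) -rmorphD -rmorphM !lecR => xy.
  rewrite leNgt; apply/negP => hx.
  have : 2 * k / h * h = 2 * k by rewrite divfK // gt_eqF.
  rewrite /rho in ry; nra.
have [M1 M10 HM] := horner_le_growth B.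
have [M M0 BM] : exists2 M : R, 0 <= M &
    forall t, `|t| <= (2 * rho)%:C -> `|B.[t]| <= M%:C.
  have M1E : M1 = (Re M1)%:C by rewrite RRe_real // ger0_real.
  exists (Re M1 * (1 + 2 * rho) ^+ (size B).-1).
    rewrite mulr_ge0 ?exprn_ge0 //; last by lra.
    by rewrite -ler0c -M1E.
  move=> t tr; apply: le_trans (HM t) _.
  rewrite rmorphM rmorphXn /= -M1E ler_wpM2l // lerXn2r ?nnegrE ?addr_ge0 //.
    by rewrite ler0c; lra.
  by rewrite rmorphD rmorph1 lerD2l.
(* With this N, the bound (h / 2)^N M on the annulus is below h^N |B(b)| = |G(b)|, against the
   maximum principle. *)
have [N HN] : exists N, M < 2 ^+ N * Bn.
  exists (Num.bound (M / Bn)); rewrite -ltr_pdivrMr //.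
  have MB : 0 <= M / Bn by rewrite divr_ge0 // ltW.
  apply: lt_le_trans (archi_boundP MB) _.
  by rewrite -natrX ler_nat ltnW // ltn_expl.
have qk t : B.[t] != 0 -> `|q t| <= K.
  move=> Bt; apply: le_trans (qK t Bt).
  by rewrite ler_peMr // lerDl.
pose G t := q t ^+ N * B.[t].
have GK t : `|G t| <= K ^+ N * `|B.[t]|.
  rewrite normrM normrX; have [->|Bt] := eqVneq B.[t] 0.
    by rewrite normr0 !mulr0.
  by rewrite ler_wpM2r // lerXn2r ?nnegrE ?(ltW K0) // qk.
have G2 t : G t != 0 -> carath 2 t G.
  rewrite mulf_eq0 negb_or => /andP[_ Bt].
  by apply: carathM; [apply: carathX; exact: q2|exact: carath_horner].
have cG : continuous G.
  move=> t; have [Gt|Gt] := eqVneq (G t) 0; last exact: carath_continuous (G2 _ Gt).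
  have [Bt|Bt] := eqVneq B.[t] 0; last first.
    apply: (@carath_continuous _ 2); apply: carathM; last exact: carath_horner.
    by apply: carathX; exact: q2.
  exact: (continuous_dominated (@carath_horner _ 0 t B) Bt GK).
have : `|G b| <= ((h / 2) ^+ N * M)%:C.
  apply: (maximum_principle cG G2 (rho := rho)).
  - by rewrite mulr_ge0 ?exprn_ge0 // divr_ge0 // ltW.
  - move=> t /andP[t1 t2]; rewrite normrM normrX.
    have [->|Bt] := eqVneq B.[t] 0.
      rewrite normr0 mulr0 ler0c mulr_ge0 ?exprn_ge0 // divr_ge0 //; exact: ltW.
    rewrite rmorphM rmorphXn /= ler_pM ?exprn_ge0 //; last exact: BM.
    apply: lerXn2r; rewrite ?nnegrE //; last exact: qh.
    by rewrite ler0c divr_ge0 // ltW.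
  - by rewrite beE ltcR /rho; lra.
rewrite normrM normrX hE BnE -rmorphXn -rmorphM lecR.
rewrite expr_div_n mulrAC ler_pdivlMr ?exprn_gt0 //.
rewrite mulrAC -mulrA ler_pM2l ?exprn_gt0 //.
by rewrite leNgt HN.
Qed.
(** Induction on k: the difference quotient of q at a point a with B(a) nonzero grows one degree
    less, and a joins the exceptional points. The extra factor 1 + |t| in the bound makes k = 0 the
    vanishing case and lets k bound the size of [Q]. *)
Lemma polynomial_growth (k : nat) (B : {poly C}) (q : C -> C) (K : C) :
  B != 0 -> (forall t, B.[t] != 0 -> carath 2 t q) ->
  (forall t, B.[t] != 0 -> `|q t| * (1 + `|t|) <= K * (1 + `|t|) ^+ k) ->
  exists2 Q : {poly C}, (size Q <= k)%N &
    forall t, B.[t] != 0 -> q t = Q.[t].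
Proof.
elim: k B q K => [|k IH] B q K B0 q2 qK.
  exists 0; first by rewrite size_poly0.
  move=> t Bt; rewrite horner0; apply: (vanishing_at_infinity q2 _ Bt) => s Bs.
  by have := qK s Bs; rewrite expr0 mulr1; exact.
have [a Ba] := numField_nonroot B0.
have one_gt0 (t : C) : 0 < 1 + `|t| :> C by rewrite ltr_pwDl.
have one_ge1 (t : C) : 1 <= 1 + `|t| :> C by rewrite lerDl.
have {}qK t : B.[t] != 0 -> `|q t| <= K * (1 + `|t|) ^+ k.
  by move=> /qK; rewrite exprSr mulrA ler_pM2r.
pose q1 t := (q t - q a) / (t - a).
pose B1 := B * ('X - a%:P).
have B1t t : B1.[t] != 0 -> B.[t] != 0 /\ t - a != 0.
  by rewrite /B1 !hornerE mulf_eq0 negb_or => /andP[].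
have B10 : B1 != 0 by rewrite mulf_neq0 // polyXsubC_eq0.
have q12 t : B1.[t] != 0 -> carath 2 t q1.
  move=> /B1t[Bt ta]; apply: carathM.
    by apply: carathD; [exact: q2|exact: carath_cst].
  apply: carathV => //; apply: carathD; [exact: carath_id|exact: carath_cst].
have [e [c [e0 c0 qe]]] : exists e c : C, [/\ 0 < e, 0 <= c &
    forall t, t - a != 0 -> `|t - a| < e -> `|q1 t| <= c].
  have [g1 cg eg] := q2 a Ba.
  have cg1 : {for a, continuous g1} := @carath_continuous _ 1 _ _ cg.
  have /nbhs_ballP[e /= e0 He] : \forall t \near a,
      `|g1 t| < `|g1 a| + 1 /\ q t = q a + (t - a) * g1 t.
    near=> t; split; last by near: t.
    have g1d : `|g1 a - g1 t| < 1.
      near: t; have /cvgrPdist_lt /(_ _ ltr01) := cg1; exact.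
    rewrite -(subrK (g1 a) (g1 t)) addrC; apply: le_lt_trans (ler_normD _ _) _.
    by rewrite ltrD2l distrC.
  exists e, (`|g1 a| + 1); split=> // t ta te.
  have /He[/ltW g1t qt] : ball a e t by rewrite -ball_normE /= distrC.
  by rewrite /q1 qt addrC addKr mulrC mulKf.
have L0 : 0 <= 1 + (1 + `|a|) / e.
  by rewrite addr_ge0 // divr_ge0 ?addr_ge0 // ltW.
have Lt t : t - a != 0 -> e <= `|t - a| ->
    1 + `|t| <= (1 + (1 + `|a|) / e) * `|t - a|.
  move=> ta te; rewrite mulrDl mul1r mulrAC -mulrA.
  apply: (@le_trans _ _ (`|t - a| + (1 + `|a|))).
    by rewrite addrCA lerD2l -[leLHS]/(`|t|) -{1}(subrK a t) ler_normD.
  by rewrite lerD2l ler_peMr ?addr_ge0 // ler_pdivlMr // mul1r.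
have er : e \is Num.real by rewrite ger0_real // ltW.
(* The first summand serves within distance e of a, where the quotient is bounded; the second serves
   beyond it, where 1 + |t| is at most a constant times |t - a|. *)
pose K1 := c * (1 + `|a| + e) + (1 + (1 + `|a|) / e) * (K + `|q a|).
have K0 : 0 <= K.
  rewrite -(pmulr_lge0 _ (exprn_gt0 k (one_gt0 a))); exact: le_trans (qK a Ba).
have [Q1 sQ1 Q1E] : exists2 Q : {poly C}, (size Q <= k)%N &
    forall t, B1.[t] != 0 -> q1 t = Q.[t].
  apply: (IH B1 q1 K1) => // t B1t0; have [Bt ta] := B1t t B1t0.
  have tk : 1 <= (1 + `|t|) ^+ k by rewrite exprn_ege1.
  have tk0 := le_trans ler01 tk.
  have K1a : 0 <= c * (1 + `|a| + e) by rewrite mulr_ge0 // !addr_ge0 // ltW.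
  have K1b : 0 <= (1 + (1 + `|a|) / e) * (K + `|q a|).
    by rewrite mulr_ge0 // addr_ge0.
  have [te|te] := real_leP er (normr_real (t - a)).
    rewrite /K1 mulrDl; apply: (ler_wpDl (mulr_ge0 K1a tk0)).
    apply: (@le_trans _ _ (`|q1 t| * ((1 + (1 + `|a|) / e) * `|t - a|))).
      by rewrite ler_wpM2l // Lt.
    have qta : `|q t - q a| <= (K + `|q a|) * (1 + `|t|) ^+ k.
      rewrite mulrDl; apply: (@le_trans _ _ (`|q t| + `|q a|)).
        exact: ler_normB.
      by apply: lerD; [exact: qK|rewrite ler_peMr].
    rewrite mulrCA -[leRHS]mulrA; apply: ler_wpM2l => //.
    by rewrite /q1 normrM normfV divfK ?normr_eq0.
  rewrite /K1 mulrDl; apply: (ler_wpDr (mulr_ge0 K1b tk0)).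
  rewrite -[leLHS]mulr1 ler_pM ?mulr_ge0 // ?(ltW (one_gt0 t)) //.
  rewrite ler_pM ?(ltW (one_gt0 t)) ?qe // -addrA lerD2l.
  rewrite -{1}(subrK a t); apply: le_trans (ler_normD _ _) _.
  by rewrite [leRHS]addrC; apply: lerD => //; exact: ltW.
exists ((q a)%:P + ('X - a%:P) * Q1).
  apply: (leq_trans (size_polyD _ _)); rewrite geq_max size_polyC.
  rewrite (leq_trans (leq_b1 _)) //=.
  have [->|Q10] := eqVneq Q1 0; first by rewrite mulr0 size_poly0.
  by rewrite size_mul ?polyXsubC_eq0 // size_XsubC.
move=> t Bt; rewrite !hornerE; have [->|ta] := eqVneq t a.
  by rewrite subrr mul0r addr0.
have ta0 : t - a != 0 by rewrite subr_eq0.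
rewrite -Q1E; last by rewrite /B1 !hornerE mulf_neq0.
by rewrite /q1 mulrC divfK // addrC subrK.
Unshelve. all: by end_near. Qed.
End Liouville.

(** * Continuous solutions of monic equations over C[t] *)

Section ContinuousAlgebraicFunction.

Lemma near_injective_seq (K : numFieldType) (P : K -> Prop) (b : K) :
  (\forall t \near b, P t) ->
  exists2 u : nat -> K, injective u & forall i, P (u i).
Proof.
(* The shift by 2 keeps the first point strictly inside the ball. *)
move=> /nbhs_ballP[e /= e0 He]; exists (fun i => b + e / i.+2%:R) => [i j|i].
  move=> /addrI /(mulfI (lt0r_neq0 e0)) /invr_inj /eqP.
  by rewrite eqr_nat => /eqP[].
apply: He; rewrite -ball_normE /= opprD addrA subrr sub0r normrN.
by rewrite gtr0_norm ?divr_gt0 // ltr_pdivrMr // ltr_pMr // ltr1n.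
Qed.

Lemma near_root_eq0 (K : numFieldType) (p : {poly K}) (b : K) :
  (\forall t \near b, p.[t] = 0) -> p = 0.
Proof.
move=> /near_injective_seq[u uI pu]; apply/eqP/negPn/negP => p0.
by have [ i] := injective_nonroot uI p0; rewrite pu eqxx.
Qed.

Lemma injective_nonroots (K : numFieldType) (p : {poly K}) : p != 0 ->
  exists2 u : nat -> K, injective u & forall i, p.[u i] != 0.
Proof.
move=> /numField_nonroot[b pb]; apply: (@near_injective_seq _ (fun t => p.[t] != 0) b).
by apply: continuous_neq0 pb; exact: (@carath_horner _ 0).
Qed.

Lemma poly_eq_off_roots (K : numFieldType) (s p q : {poly K}) : s != 0 ->
  (forall t, s.[t] != 0 -> p.[t] = q.[t]) -> p = q.
Proof.
move=> s0 pq; apply/eqP; rewrite -subr_eq0; apply/negPn/negP => pq0.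
have /numField_nonroot[t] : s * (p - q) != 0 by rewrite mulf_neq0.
by rewrite hornerM hornerD hornerN mulf_eq0 negb_or => /andP[/pq->]; rewrite subrr eqxx.
Qed.

(** Cauchy's bound: if |x| > 1, division by x^(N-1) leaves each c_i multiplied by a power of x of
    modulus at most 1. *)
Lemma monic_root_bound (K : numFieldType) (N : nat) (c : 'I_N -> K) (x : K) :
  x ^+ N + \sum_(i < N) c i * x ^+ i = 0 -> `|x| <= 1 + \sum_(i < N) `|c i|.
Proof.
case: N c => [|N] c; first by rewrite big_ord0 addr0 => /eqP; rewrite oner_eq0.
have S0 : 0 <= \sum_(i < N.+1) `|c i| by apply: sumr_ge0.
move=> /eqP; rewrite addr_eq0 => /eqP xN.
have [x1|x1] := real_leP (normr_real x) (real1 K).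
  by apply: (le_trans x1); rewrite lerDl.
apply: ler_wpDl => //.
have x0 : 0 < `|x| ^+ N by rewrite exprn_gt0 // (lt_trans ltr01).
rewrite -(ler_pM2r x0) -exprS -normrX xN normrN.
apply: (le_trans (ler_norm_sum _ _ _)).
rewrite mulr_suml; apply: ler_sum => i _; rewrite normrM normrX.
apply: ler_wpM2l => //; apply: ler_weXn2l; first exact: ltW.
by rewrite -ltnS.
Qed.

Variable R : realType.
Local Notation C := (R[i] : numFieldType).

(** The monic equation bounds e by a multiple of (1 + |t|)^k, and algebraicity gives two orders of
    regularity off the roots of some B, so Liouville's theorem applies off the roots of B s. *)
Lemma continuous_algebraic_polynomial (s : {poly C}) (N k : nat)
    (c : 'I_N -> {poly C}) (e : C -> C) :
  s != 0 -> (forall i, (size (c i) <= k)%N) ->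
  (forall t, s.[t] != 0 -> {for t, continuous e}) ->
  (forall t, s.[t] != 0 -> e t ^+ N + \sum_(i < N) (c i).[t] * e t ^+ i = 0) ->
  exists2 Q : {poly C}, (size Q <= k.+1)%N &
    forall t, s.[t] != 0 -> e t = Q.[t].
Proof.
move=> s0 sc ce ec.
pose P : {poly {poly C}} := 'X^N + \sum_(i < N) c i *: 'X^i.
have PE t x : P.[x%:P].[t] = x ^+ N + \sum_(i < N) (c i).[t] * x ^+ i.
  rewrite /P hornerD hornerXn horner_sum hornerD horner_exp hornerC; congr (_ + _).
  rewrite horner_sum; apply: eq_bigr => i _.
  by rewrite hornerZ hornerXn hornerM horner_exp hornerC.
have P0 : P != 0.
  apply/eqP => /(congr1 (fun p : {poly {poly C}} => p`_N)).
  rewrite coefD coefXn eqxx coef_sum big1 ?addr0 ?coef0 => [/eqP|i _].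
    by rewrite oner_eq0.
  by rewrite coefZ coefXn gtn_eqF // mulr0.
have [B B0 HB] := @algebraic_carath _ P 2 P0.
have Bs0 : B * s != 0 by rewrite mulf_neq0.
have s_open t : s.[t] != 0 -> \forall u \near t, s.[u] != 0.
  exact/continuous_neq0/(@carath_horner _ 0).
have e2 t : (B * s).[t] != 0 -> carath 2 t e.
  rewrite hornerM mulf_eq0 negb_or => /andP[Bt st].
  apply: HB => //; first exact: ce.
  by apply: filterS (s_open t st) => u su; rewrite PE ec.
have growth i : exists M : C,
    0 <= M /\ forall t, `|(c i).[t]| <= M * (1 + `|t|) ^+ k.
  have [M M0 HM] := horner_le_growth (c i); exists M; split=> // t.
  apply: le_trans (HM t) _; apply: ler_wpM2l => //; apply: ler_weXn2l.
    by rewrite lerDl.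
  exact: leq_trans (leq_pred _) (sc i).
have [M HM] := choice growth.
have [Q sQ eQ] : exists2 Q : {poly C}, (size Q <= k.+1)%N &
    forall t, (B * s).[t] != 0 -> e t = Q.[t].
  apply: (polynomial_growth (K := 1 + \sum_(i < N) M i) Bs0 e2) => t.
  rewrite hornerM mulf_eq0 negb_or => /andP[_ st].
  rewrite exprSr mulrA; apply: ler_wpM2r; first by rewrite addr_ge0.
  apply: (le_trans (monic_root_bound (ec t st))).
  rewrite mulrDl mul1r lerD // ?exprn_ege1 ?lerDl //.
  by rewrite mulr_suml; apply: ler_sum => i _; case: (HM i).
(* The roots of B are recovered by continuity: if e and Q differed at t, they would differ nearby,
   and B s would vanish on a neighbourhood. *)
exists Q => // t st; apply/eqP; rewrite -subr_eq0; apply/negPn/negP => eQt.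
have /near_root_eq0 /eqP : \forall u \near t, (B * s).[u] = 0.
  have : \forall u \near t, e u - Q.[u] != 0.
    apply: (@continuous_neq0 _ t (fun u => e u - Q.[u])) => //.
    apply: (@carathD _ 0 t e (fun u => - Q.[u])); first exact: ce.
    apply: (@carath_near _ 0 t (fun u => (- Q).[u])); last exact: carath_horner.
    by near=> u; rewrite hornerN.
  apply: filterS => u; rewrite subr_eq0 => eQu; apply/eqP/negPn/negP => Bu.
  by rewrite eQ ?eqxx in eQu.
exact/negP.
Unshelve. all: by end_near. Qed.
End ContinuousAlgebraicFunction.

(** * Polynomial functions of several variables and their restrictions to lines *)

Section PolynomialFunctions.
Variable R : realType.
Local Notation C := R[i].

(** Structural induction on polynomial expressions, phrased for a property of functions so that it
    yields continuity, degree bounds and fractions alike. *)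
Lemma ev_closed (T : Type) (P : (T -> C) -> Prop) n (L : T -> 'rV[C]_n)
    (q : mpoly.mpoly n C) :
  (forall c, P (fun=> c)) ->
  (forall f g, P f -> P g -> P (fun t => f t + g t)) ->
  (forall f g, P f -> P g -> P (fun t => f t * g t)) ->
  (forall i, P (fun t => L t ord0 i)) -> P (fun t => ev q (L t)).
Proof.
move=> Pc PD PM PL.
have -> : (fun t => ev q (L t)) = fun t => \sum_(m <- mpoly.msupp q)
    mpoly.mcoeff m q * \prod_(i < n) L t ord0 i ^+ mpoly.fun_of_multinom m i.
  by apply/funext => t; rewrite /ev mpoly.mevalE.
elim: (mpoly.msupp q) => [|m r IH].
  by under eq_fun do rewrite big_nil; exact: Pc.
under eq_fun do rewrite big_cons; apply: (PD) => //.
apply: (PM) => //; elim: (index_enum _) => [|i e IHe].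
  by under eq_fun do rewrite big_nil; exact: Pc.
under eq_fun do rewrite big_cons; apply: (PM) => //.
elim: (mpoly.fun_of_multinom m i) => [|j IHj]; first exact: Pc.
by under eq_fun do rewrite exprS; exact: PM.
Qed.

Definition polyfun (n : nat) (phi : 'rV[C]_n -> C) : Prop :=
  exists q : mpoly.mpoly n C, forall x, phi x = ev q x.

Lemma polyfun_ev n (q : mpoly.mpoly n C) : polyfun (ev q).
Proof. by exists q. Qed.

Lemma polyfun_cst n (c : C) : polyfun (fun _ : 'rV[C]_n => c).
Proof. by exists (mpoly.mpolyC n c) => x; rewrite /ev mpoly.mevalC. Qed.

Lemma polyfun_coord n (i : 'I_n) : polyfun (fun x : 'rV[C]_n => x ord0 i).
Proof.
by exists (mpoly.mpolyX C (mpoly.mnm1 i)) => x; rewrite /ev mpoly.mevalXU.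
Qed.

Lemma polyfunD n (f g : 'rV[C]_n -> C) :
  polyfun f -> polyfun g -> polyfun (fun x => f x + g x).
Proof.
by move=> [p pE] [q qE]; exists (p + q) => x; rewrite /ev mpoly.mevalD pE qE.
Qed.

Lemma polyfunM n (f g : 'rV[C]_n -> C) :
  polyfun f -> polyfun g -> polyfun (fun x => f x * g x).
Proof.
by move=> [p pE] [q qE]; exists (p * q) => x; rewrite /ev mpoly.mevalM pE qE.
Qed.

Lemma eq_polyfun n (f g : 'rV[C]_n -> C) : f =1 g -> polyfun f -> polyfun g.
Proof. by move=> fg [p pE]; exists p => x; rewrite -fg. Qed.

Lemma polyfun_sum n (I : Type) (r : seq I) (f : I -> 'rV[C]_n -> C) :
  (forall i, polyfun (f i)) -> polyfun (fun x => \sum_(i <- r) f i x).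
Proof.
move=> pf; elim: r => [|i r IH].
  by apply: eq_polyfun (polyfun_cst n 0) => x; rewrite big_nil.
by apply: eq_polyfun (polyfunD (pf i) IH) => x; rewrite big_cons.
Qed.

Lemma polyfun_prod n (I : Type) (r : seq I) (f : I -> 'rV[C]_n -> C) :
  (forall i, polyfun (f i)) -> polyfun (fun x => \prod_(i <- r) f i x).
Proof.
move=> pf; elim: r => [|i r IH].
  by apply: eq_polyfun (polyfun_cst n 1) => x; rewrite big_nil.
by apply: eq_polyfun (polyfunM (pf i) IH) => x; rewrite big_cons.
Qed.

Lemma polyfunX n (f : 'rV[C]_n -> C) k :
  polyfun f -> polyfun (fun x => f x ^+ k).
Proof.
move=> pf; elim: k => [|k IH]; first exact: polyfun_cst.
by apply: eq_polyfun (polyfunM pf IH) => x; rewrite exprS.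
Qed.

Lemma polyfun_horner n (q : {poly C}) (f : 'rV[C]_n -> C) :
  polyfun f -> polyfun (fun x => q.[f x]).
Proof.
move=> pf; apply: (@eq_polyfun _ (fun x => \sum_(i < size q) q`_i * f x ^+ i)).
  by move=> x; rewrite horner_coef.
by apply: polyfun_sum => i; apply: polyfunM; [exact: polyfun_cst|exact: polyfunX].
Qed.

Lemma polyfun_comp n n' (f : 'rV[C]_n -> C) (L : 'rV[C]_n' -> 'rV[C]_n) :
  polyfun f -> (forall i, polyfun (fun x => L x ord0 i)) ->
  polyfun (fun x => f (L x)).
Proof.
move=> [q qE] pL; apply: (@eq_polyfun _ (fun x => ev q (L x))) => [x //|].
apply: ev_closed => //; first exact: polyfun_cst.
  exact: polyfunD.
exact: polyfunM.
Qed.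

(** The bound has to be uniform over all lines, since it fixes the number of interpolation nodes. *)
Lemma ev_line n (q : mpoly.mpoly n C) : exists k : nat,
  forall a v : 'rV[C]_n, exists2 l : {poly C}, (size l <= k)%N &
    forall t, l.[t] = ev q (a + t *: v).
Proof.
pose bounded (f : 'rV[C]_n -> C) := exists k : nat,
  forall a v : 'rV[C]_n, exists2 l : {poly C}, (size l <= k)%N &
    forall t, l.[t] = f (a + t *: v).
have bC c : bounded (fun=> c).
  exists 1%N => a v; exists c%:P => [|t]; last by rewrite hornerC.
  by rewrite size_polyC leq_b1.
have bD f g : bounded f -> bounded g -> bounded (fun x => f x + g x).
  move=> [k Hf] [k' Hg]; exists (maxn k k') => a v.
  have [[l sl lE] [l' sl' lE']] := (Hf a v, Hg a v).
  exists (l + l') => [|t]; last by rewrite hornerD lE lE'.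
  apply: (leq_trans (size_polyD _ _)).
  by rewrite geq_max !leq_max sl sl' orbT.
have bM f g : bounded f -> bounded g -> bounded (fun x => f x * g x).
  move=> [k Hf] [k' Hg]; exists (k + k')%N => a v.
  have [[l sl lE] [l' sl' lE']] := (Hf a v, Hg a v).
  exists (l * l') => [|t]; last by rewrite hornerM lE lE'.
  apply: (leq_trans (size_polyMleq _ _)); apply: leq_trans (leq_pred _) _.
  exact: leq_add.
have bX i : bounded (fun x => x ord0 i).
  exists 2%N => a v; exists ((a ord0 i)%:P + v ord0 i *: 'X) => [|t].
    apply: (leq_trans (size_polyD _ _)); rewrite geq_max size_polyC.
    rewrite (leq_trans (leq_b1 _)) //=; apply: leq_trans (size_scale_leq _ _) _.
    by rewrite size_polyX.
  by rewrite hornerD hornerC hornerZ hornerX !mxE mulrC.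
exact: (ev_closed (P := bounded) (L := id)).
Qed.

Lemma polyfun_line n (f : 'rV[C]_n -> C) (a v : 'rV[C]_n) : polyfun f ->
  exists l : {poly C}, forall t, l.[t] = f (a + t *: v).
Proof.
move=> [q qE]; have [k /(_ a v)[l _ lE]] := ev_line q.
by exists l => t; rewrite lE qE.
Qed.

Definition merge n (r : nat) (c x : 'rV[C]_n) : 'rV[C]_n :=
  \row_i (if (i < r)%N then x ord0 i else c ord0 i).

(* Lagrange interpolation in one coordinate after the other: at stage [r], [H]
   is known to be polynomial on the affine subspace where the coordinates of
   index at least [r] are frozen at those of a base point [c], [s c <> 0]. *)
Lemma polynomial_on_lines n (s : mpoly.mpoly n C) (k : nat) (H : 'rV[C]_n -> C) :
  (forall (a v : 'rV[C]_n) t0, ev s (a + t0 *: v) != 0 ->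
    exists2 Q : {poly C}, (size Q <= k.+1)%N &
      forall t, ev s (a + t *: v) != 0 -> H (a + t *: v) = Q.[t]) ->
  exists Q : mpoly.mpoly n C, forall x, ev s x != 0 -> H x = ev Q x.
Proof.
move=> HL.
have polyfun_merge r c : polyfun (fun x => ev s (merge r c x)).
  apply: polyfun_comp; first exact: polyfun_ev.
  move=> i; apply: (@eq_polyfun _ (fun x => if (i < r)%N then x ord0 i else c ord0 i)).
    by move=> x; rewrite mxE.
  by case: (i < r)%N; [exact: polyfun_coord|exact: polyfun_cst].
suff main r : (r <= n)%N -> forall c, ev s c != 0 ->
    exists Q : mpoly.mpoly n C,
      forall x, ev s (merge r c x) != 0 -> H (merge r c x) = ev Q x.
  have mergen (c x : 'rV[C]_n) : merge n c x = x.
    by apply/rowP => i; rewrite mxE ltn_ord.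
  have [[c sc]|nc] := pselect (exists c, ev s c != 0).
    have [Q QE] := main n (leqnn n) c sc.
    by exists Q => x; have := QE x; rewrite mergen.
  by exists 0; move=> x sx; case: nc; exists x.
elim: r => [|r IH] rn c sc.
  have m0 x : merge 0 c x = c by apply/rowP => i; rewrite mxE.
  have [q qE] := polyfun_cst n (H c); exists q => x _.
  by rewrite m0 -qE.
pose i0 := Ordinal rn; pose e : 'rV[C]_n := delta_mx ord0 i0.
(* The point [c] with its coordinate [i0] replaced by [t]. *)
pose c' t := c - c ord0 i0 *: e + t *: e.
have c'c : c' (c ord0 i0) = c by rewrite /c' subrK.
have [l lE] := polyfun_line (c - c ord0 i0 *: e) e (polyfun_ev s).
(* A nonzero [l] provides infinitely many nodes [u i] for which [c' (u i)] is again an admissible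
   base point. *)
have l0 : l != 0.
  apply: contraNneq sc => l0; have := lE (c ord0 i0).
  by rewrite l0 horner0 -/(c' _) c'c => <-.
have [u uI lu] := injective_nonroots l0.
have su i : ev s (c' (u i)) != 0 by rewrite -lE.
have [Qi QiE] := choice (fun i => IH (ltnW rn) _ (su i)).
have merge_c' t x : merge r (c' t) x =
    merge r c x - c ord0 i0 *: e + t *: e.
  apply/rowP => i; rewrite !mxE eqxx /=; case: ifP => // ir.
  rewrite (_ : (i == i0) = false) ?mulr0 ?subr0 ?addr0 //.
  by apply/eqP => ii; rewrite ii /= ltnn in ir.
have mergeS x : merge r.+1 c x = merge r (c' (x ord0 i0)) x.
  apply/rowP => i; rewrite !mxE eqxx /= ltnS leq_eqVlt.
  have [ii|ii] /= := eqVneq (i : nat) r.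
    have -> : i = i0 by apply: val_inj.
    by rewrite eqxx /= ltnn !mulr1 subrr add0r.
  case: ifP => // _; rewrite (_ : (i == i0) = false) ?mulr0 ?subr0 ?addr0 //.
  by apply/eqP => ii'; rewrite ii' eqxx in ii.
pose L i : {poly C} := tnth (qpoly.lagrange k.+1 u) i.
pose d x := \prod_(i < k.+1) ev s (merge r (c' (u i)) x).
have [Q QE] : polyfun (fun x => \sum_(i < k.+1) ev (Qi i) x * (L i).[x ord0 i0]).
  apply: polyfun_sum => i; apply: polyfunM; first exact: polyfun_ev.
  exact/polyfun_horner/polyfun_coord.
(* When [d x] is nonzero, all k.+1 nodes are usable on the line through [merge r.+1 c x] in
   direction [e], and they determine H there. *)
have generic x : ev s (merge r.+1 c x) != 0 -> d x != 0 ->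
    H (merge r.+1 c x) = ev Q x.
  rewrite mergeS merge_c' => sx dx.
  have [P sP PE] := HL _ _ _ sx.
  rewrite PE // -QE (qpoly.lagrange_gen (ltn0Sn k) uI sP) horner_sum.
  apply: eq_bigr => i _; rewrite hornerM hornerC; congr (_ * _).
  have sdx : ev s (merge r (c' (u i)) x) != 0.
    by move: dx; rewrite /d => /prodf_neq0 /(_ i isT).
  by rewrite -QiE // merge_c' PE // -merge_c'.
(* To drop the condition on [d], join [x] to [c], where [d] is nonzero: along this line H after
   [merge] and Q are given by polynomials that agree off the roots of S D, hence also at [x]. *)
exists Q => x sx.
have [S SE] := polyfun_line x (c - x) (polyfun_merge r.+1 c).
have [D DE] : exists D : {poly C}, forall t, D.[t] = d (x + t *: (c - x)).
  by apply: polyfun_line; apply: polyfun_prod => i; exact: polyfun_merge.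
have [q qE] := polyfun_line x (c - x) (polyfun_ev Q).
have mergeL t : merge r.+1 c (x + t *: (c - x)) =
    merge r.+1 c x + t *: (c - merge r.+1 c x).
  apply/rowP => i; rewrite !mxE; case: ifP => // _.
  by rewrite subrr mulr0 addr0.
have S0 : S != 0.
  apply: contraNneq sx => S0; have := SE 0.
  by rewrite S0 horner0 scale0r addr0 => <-.
have D0 : D != 0.
  have : D.[1] != 0.
    rewrite DE scale1r addrC subrK /d; apply/prodf_neq0 => i _.
    rewrite (_ : merge _ _ _ = c' (u i)) //; apply/rowP => j.
    rewrite !mxE; case: ifP => // jr; rewrite (_ : (j == i0) = false).
      by rewrite andbF !mulr0 subr0 addr0.
    by apply/eqP => jj; rewrite jj /= ltnn in jr.
  by apply: contraNneq => ->; rewrite horner0.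
have sx0 : ev s (merge r.+1 c x + 0 *: (c - merge r.+1 c x)) != 0.
  by rewrite scale0r addr0.
have [P _ PE] := HL _ _ _ sx0.
have Pq : P = q.
  apply: (@poly_eq_off_roots _ (S * D)); first by rewrite mulf_neq0.
  move=> t; rewrite hornerM mulf_eq0 negb_or => /andP[St Dt].
  rewrite SE in St; rewrite DE in Dt.
  by rewrite qE -generic // -PE ?mergeL // -mergeL.
have := PE 0; rewrite scale0r addr0 => ->//.
by rewrite Pq qE scale0r addr0.
Qed.
End PolynomialFunctions.

Lemma continuous_on_line (K : numFieldType) n (H : 'rV[K]_n -> K) (a v : 'rV[K]_n)
    (t : K) :
  {for a + t *: v, continuous H} -> {for t, continuous (fun u : K => H (a + u *: v))}.
Proof.
move=> cH.
have line : {for t, continuous (fun u : K => a + u *: v)}.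
  have cv : (fun u : K => u *: v) @ t --> t *: v.
    by apply: (@cvgZr_tmp _ _ _ (nbhs t) _ id t v).
  exact: (cvgD (cvg_cst a) cv).
exact: (continuous_comp line cH).
Qed.

(** * Continuous functions integral over a localized polynomial ring *)

Section IntegralFunctions.
Variable R : realType.
Local Notation C := (R[i] : numFieldType).

Lemma integral_polynomial n (s : mpoly.mpoly n C) (N : nat)
    (c : 'I_N -> mpoly.mpoly n C) (H : 'rV[C]_n -> C) :
  (forall x : 'rV[C]_n, ev s x != 0 -> {for x, continuous H}) ->
  (forall x, ev s x != 0 ->
    H x ^+ N + \sum_(i < N) ev (c i) x * H x ^+ i = 0) ->
  exists Q : mpoly.mpoly n C, forall x, ev s x != 0 -> H x = ev Q x.
Proof.
move=> cH cHs; have [k kP] := choice (fun i => ev_line (c i)).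
apply: (@polynomial_on_lines _ _ s (\max_i k i)) => a v t0 st0.
have [l lE] := polyfun_line a v (polyfun_ev s).
have cl i : exists l : {poly C}, (size l <= k i)%N /\
    forall t, l.[t] = ev (c i) (a + t *: v).
  by have [p] := kP i a v; exists p.
have [L LP] := choice cl.
have l0 : l != 0 by apply: contraNneq st0 => l0; rewrite -lE l0 horner0.
have [||t st|Q sQ QE] := @continuous_algebraic_polynomial _ l N (\max_i k i) L
    (fun t => H (a + t *: v)) l0.
- by move=> i; apply: leq_trans (leq_bigmax i); case: (LP i).
- by move=> t; rewrite lE => /cH; exact: continuous_on_line.
- rewrite lE in st; rewrite -[RHS](cHs _ st); congr (_ + _).
  by apply: eq_bigr => i _; congr (_ * _); case: (LP i).
by exists Q => // t st; apply: QE; rewrite lE.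
Qed.

(** Membership in C[x][1/s], as functions on the set s <> 0. All large exponents are allowed, so
    that finitely many fractions share one. *)
Definition fraction_of n (s : mpoly.mpoly n C) (f : 'rV[C]_n -> C) : Prop :=
  exists d : nat, forall e, (d <= e)%N -> exists A : mpoly.mpoly n C,
    forall x, ev s x != 0 -> f x * ev s x ^+ e = ev A x.

Lemma fraction_ofP n (s : mpoly.mpoly n C) f d (A : mpoly.mpoly n C) :
  (forall x, ev s x != 0 -> f x * ev s x ^+ d = ev A x) -> fraction_of s f.
Proof.
move=> fA; exists d => e de; exists (A * s ^+ (e - d)) => x sx.
rewrite -{1}(subnKC de) exprD mulrA fA // /ev mpoly.mevalM; congr (_ * _).
by rewrite rmorphXn.
Qed.

Lemma fraction_of_ev n m (s : mpoly.mpoly n C) (f : 'rV[C]_n -> 'rV[C]_m)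
    (r : mpoly.mpoly m C) :
  (forall j, fraction_of s (fun x => f x ord0 j)) ->
  fraction_of s (fun x => ev r (f x)).
Proof.
move=> ff; apply: ev_closed => // [c|g h|g h].
- have [A AE] := polyfun_cst n c.
  by apply: (@fraction_ofP _ _ _ 0 A) => x _; rewrite expr0 mulr1 -AE.
- move=> [d Hd] [d' Hd']; exists (maxn d d') => e; rewrite geq_max.
  move=> /andP[/Hd[A AE] /Hd'[A' AE']]; exists (A + A') => x sx.
  by rewrite mulrDl AE // AE' // /ev mpoly.mevalD.
- move=> [d /(_ d (leqnn d))[A AE]] [d' /(_ d' (leqnn d'))[A' AE']].
  apply: (@fraction_ofP _ _ _ (d + d') (A * A')) => x sx.
  by rewrite exprD mulrACA AE // AE' // /ev mpoly.mevalM.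
Qed.

Lemma ev_continuous n (q : mpoly.mpoly n C) :
  continuous (ev q : 'rV[C]_n -> C).
Proof.
move=> x; apply: (@ev_closed _ _ (fun f : 'rV[C]_n -> C =>
  {for x, continuous f}) n id q).
- by move=> c; exact: cst_continuous.
- by move=> f g cf cg; exact: (cvgD cf cg).
- by move=> f g cf cg; exact: (cvgM cf cg).
- by move=> i; exact: coord_continuous.
Qed.

Lemma integral_fraction n (s : mpoly.mpoly n C) (N : nat)
    (c : 'I_N -> 'rV[C]_n -> C) (h : 'rV[C]_n -> C) :
  (forall x : 'rV[C]_n, ev s x != 0 -> {for x, continuous h}) ->
  (forall i, fraction_of s (c i)) ->
  (forall x, ev s x != 0 -> h x ^+ N + \sum_(i < N) c i x * h x ^+ i = 0) ->
  fraction_of s h.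
Proof.
move=> ch fc hc; have [d dP] := choice fc; pose D := \max_i d i.
have [A AE] := choice (fun i => dP i D (leq_bigmax i)).
(* Multiplying the equation by s^(D N) turns c_i into c_i s^(D (N - i)); one factor s^D is already
   absorbed in [A i]. *)
pose b i : mpoly.mpoly n C := A i * s ^+ (D * (N - i).-1).
have evX k x : ev (s ^+ k) x = ev s x ^+ k by rewrite /ev rmorphXn.
have [||Q QE] := @integral_polynomial n s N b (fun x => h x * ev s x ^+ D).
- move=> x sx; rewrite (_ : (fun _ => _) = fun y => h y * ev (s ^+ D) y).
    exact: (cvgM (ch x sx) (@ev_continuous n (s ^+ D) x)).
  by apply/funext => y; rewrite evX.
- move=> x sx; transitivity (0 * ev s x ^+ (D * N)); last by rewrite mul0r.
  rewrite -[in RHS](hc x sx) mulrDl exprMn -exprM; congr (_ + _); rewrite mulr_suml.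
  apply: eq_bigr => i _; rewrite /b [ev (_ * _) _]mpoly.mevalM -/(ev _ _).
  rewrite -/(ev _ _) evX -AE // exprMn -exprM.
  have -> : (D * N = D + D * (N - i).-1 + D * i)%N.
    by have := ltn_ord i; nia.
  rewrite !exprD; ring.
by apply: (@fraction_ofP _ _ _ D Q) => x sx; exact: QE.
Qed.
End IntegralFunctions.

(** * The polynomial whose roots are the values of a coordinate on an orbit *)

Section OrbitPolynomial.
Variables (R : realType) (n : nat) (G : seq 'M[R[i]]_n) (j : 'I_n).
Local Notation C := R[i].

(** The list [G] may repeat elements with unequal multiplicities, which would spoil invariance;
    hence [undup]. *)
Definition orbit_poly (x : 'rV[C]_n) : {poly C} :=
  \prod_(g <- undup G) ('X - (act g x ord0 j)%:P).

Lemma polyfun_prod_coef (I : Type) (r : seq I) (p : I -> 'rV[C]_n -> {poly C}) :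
  (forall i k, polyfun (fun x => (p i x)`_k)) ->
  forall k, polyfun (fun x => (\prod_(i <- r) p i x)`_k).
Proof.
move=> pp; elim: r => [|i r IH] k.
  by under eq_fun do rewrite big_nil; exact: polyfun_cst.
under eq_fun do rewrite big_cons coefM.
by apply: polyfun_sum => l; apply: polyfunM.
Qed.

Lemma polyfun_orbit_coef k : polyfun (fun x => (orbit_poly x)`_k).
Proof.
apply: polyfun_prod_coef => g l.
have pa : polyfun (fun x => act g x ord0 j).
  under eq_fun do rewrite /act mxE.
  by apply: polyfun_sum => i; apply: polyfunM; [exact: polyfun_coord|exact: polyfun_cst].
under eq_fun do rewrite coefB coefX coefC.
apply: polyfunD; first exact: polyfun_cst.
apply: (@eq_polyfun _ _ (fun x => (-1) * (if l == 0%N then act g x ord0 j else 0))).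
  by move=> x; rewrite mulN1r.
apply: polyfunM; first exact: polyfun_cst.
by case: (l == 0%N); [exact: pa|exact: polyfun_cst].
Qed.

Hypothesis Ggrp : finite_matrix_group G.

(** Right translation by g is injective and maps the finite set G into itself, so it permutes the
    factors. *)
Lemma orbit_poly_act g x : g \in G -> orbit_poly (act g x) = orbit_poly x.
Proof.
case: Ggrp => G1 GM GU gG.
have injg : injective (fun h : 'M[C]_n => h *m g).
  exact: (can_inj (mulmxK (GU g gG))).
have eqG : perm_eq [seq h *m g | h <- undup G] (undup G).
  have uGg : uniq [seq h *m g | h <- undup G] by rewrite map_inj_uniq ?undup_uniq.
  apply: uniq_perm; rewrite ?undup_uniq //.
  have subG : {subset [seq h *m g | h <- undup G] <= undup G}.
    by move=> _ /mapP[h + ->]; rewrite !mem_undup => hG; exact: GM.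
  by have [|//] := uniq_min_size uGg subG; rewrite size_map.
rewrite /orbit_poly -[RHS](perm_big _ eqG) big_map; apply: eq_bigr => h _.
by rewrite /act trmx_mul mulmxA.
Qed.

Lemma orbit_poly_root x : (orbit_poly x).[x ord0 j] = 0.
Proof.
case: Ggrp => G1 _ _; rewrite /orbit_poly horner_prod.
rewrite (bigD1_seq 1%:M) ?mem_undup ?undup_uniq //=.
have -> : act 1%:M x = x by rewrite /act trmx1 mulmx1.
by rewrite hornerXsubC subrr mul0r.
Qed.

Lemma orbit_poly_equation (x : 'rV[C]_n) (N := size (undup G)) :
  x ord0 j ^+ N + \sum_(i < N) (orbit_poly x)`_i * x ord0 j ^+ i = 0.
Proof.
have := orbit_poly_root x; rewrite horner_coef size_prod_XsubC big_ord_recr /=.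
have := monicP (monic_prod_XsubC (undup G) xpredT (fun g => act g x ord0 j)).
by rewrite lead_coefE size_prod_XsubC /= -/(orbit_poly x) => ->; rewrite mul1r addrC.
Qed.

(** Each coefficient is an invariant polynomial. Taken at F(x), it thus depends only on f(x). *)
Lemma orbit_coef_generated m (sigma : m.-tuple (mpoly.mpoly n C)) k :
  generates G sigma -> exists r : mpoly.mpoly m C,
    forall x, (orbit_poly x)`_k = ev r (quot_map sigma x).
Proof.
move=> gen; have [q qE] := polyfun_orbit_coef k.
have [|r rE] := gen q; first by move=> g gG x; rewrite -!qE orbit_poly_act.
exists r => x; rewrite qE rE /ev mpoly.comp_mpoly_meval.
by apply: mpoly.meval_eq => i; rewrite mxE.
Qed.
End OrbitPolynomial.

(** Take for [s] the product of a polynomial from the description of U, nonzero at x, and of local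
    denominators of all coordinates of f at x. Each denominator divides [s], so exponent 1
    suffices. *)
Lemma common_denominator (R : realType) m p (W U : set 'rV[R[i]]_p)
    (f : 'rV[R[i]]_p -> 'rV[R[i]]_m) x :
  zariski_open U -> U `<=` W -> regular_map W f -> U x ->
  exists s : mpoly.mpoly p R[i], [/\ ev s x != 0,
    (forall y, ev s y != 0 -> U y) &
    forall j, fraction_of s (fun y => f y ord0 j)].
Proof.
move=> [S US] UW fW Ux.
have [s0 s0S s0x] : exists2 s, s \in S & ev s x != 0.
  by move: Ux; rewrite US => /hasP.
have s0U y : ev s0 y != 0 -> U y.
  by move=> s0y; rewrite US; apply/hasP; exists s0.
have ab j : exists ab : mpoly.mpoly p R[i] * mpoly.mpoly p R[i],
    ev ab.2 x != 0 /\ forall y, W y -> ev ab.2 y != 0 ->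
      f y ord0 j = ev ab.1 y / ev ab.2 y.
  by have [a [b abE]] := fW j x (UW x Ux); exists (a, b).
have [c cE] := choice ab.
have evM q q' y : ev (q * q') y = ev q y * ev q' y :> R[i].
  exact: mpoly.mevalM.
exists (s0 * \prod_j (c j).2).
have sE y : ev (s0 * \prod_j (c j).2) y = ev s0 y * \prod_j ev (c j).2 y.
  by rewrite evM /ev rmorph_prod.
split=> [|y|j].
- rewrite sE mulf_neq0 //; apply/prodf_neq0 => j _; by case: (cE j).
- by rewrite sE mulf_eq0 negb_or => /andP[/s0U].
apply: (@fraction_ofP _ _ _ _ 1
  ((c j).1 * (s0 * \prod_(i | i != j) (c i).2))) => y.
rewrite expr1 sE mulf_eq0 negb_or => /andP[s0y /prodf_neq0 cy].
have [_ fE] := cE j; rewrite fE ?cy //; last exact/UW/s0U.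
rewrite !evM (bigD1 j) //= /ev rmorph_prod /= -!/(ev _ _).
by field; exact: cy.
Qed.

Unset Implicit Arguments.

Theorem theorem4p5 (R : realType) (n m p : nat) (G : seq 'M[R[i]]_n)
  (sigma : m.-tuple (mpoly.mpoly n R[i]))
  (W U : set 'rV[R[i]]_p) (f : 'rV[R[i]]_p -> 'rV[R[i]]_m)
  (F : 'rV[R[i]]_p -> 'rV[R[i]]_n) :
  finite_matrix_group G ->
  min_hom_generators G sigma ->
  (* f : C^p --> Z rational morphism, with domain of definition W, regular on U *)
  zariski_open W -> zariski_open U -> U `<=` W ->
  regular_map W f -> f @` W `<=` quotZ sigma ->
  (* f^{-1}(Z_0) is nonempty *)
  (exists x, W x /\ Z0 G sigma (f x)) ->
  (* F : U -> V holomorphic with pi o F = f on U *)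
  holomorphic_on U F ->
  (forall x, U x -> quot_map sigma (F x) = f x) ->
  regular_map U F.
Proof.
move=> finG [_ gen _] _ zU UW fW _ _ holF piF j x Ux.
have [s [sx sU fs]] := common_denominator zU UW fW Ux.
have [r rE] := choice (fun k => orbit_coef_generated j finG k gen).
have [|||d /(_ d (leqnn d))[A AE]] := @integral_fraction R p s (size (undup G))
  (fun i y => ev (r i) (f y)) (fun y => F y ord0 j).
- move=> y sy; have /differentiable_continuous cF := holF y (sU y sy).
  exact: (continuous_comp cF (@coord_continuous _ _ _ ord0 j _)).
- by move=> i; exact: fraction_of_ev.
- move=> y sy; rewrite -[RHS](orbit_poly_equation j finG (F y)); congr (_ + _).
  by apply: eq_bigr => i _; rewrite rE piF //; exact: sU.
have evX k y : ev (s ^+ k) y = ev s y ^+ k by rewrite /ev rmorphXn.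
(* The additional factor [s] covers d = 0: a nonzero denominator must imply that [s] is nonzero. *)
exists (A * s), (s ^+ d.+1); rewrite evX expf_neq0 //; split=> // y Uy.
rewrite evX expf_eq0 /= => sy; apply: (mulIf (expf_neq0 d.+1 sy)).
rewrite divfK ?expf_neq0 // exprSr mulrA AE // /ev.
by rewrite mpoly.mevalM.
Qed.
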